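(* Let $(V,d)$ be a complete metric space, $G$ a connected open subset of $V$, $f:G\to G$ a map that is nonexpansive with respect to $d$ (i.e. $d(f(x),f(y))\le d(x,y)$ for all $x,y\in G$), and $v\in G$ a fixed point of $f$: $f(v)=v$. Assume: (B1) There exists a real Banach space $(E,\|\cdot\|_E)$ such that $V$ is an open subset of $E$, and such that for any $U\subset V$, $U$ is open in the $d$-metric topology if and only if it is open in the norm topology of $E$. In addition, for every $\lambda>1$ there exists a neighborhood $U$ of $v$ in $(V,d)$ such that $\lambda^{-1}\|x-y\|_E\le d(x,y)\le \lambda\|x-y\|_E$ for all $x,y\in U$. (A1) $f:G\to E$ is semidifferentiable at $v$, with semidifferential $f'_v:E\to E$. Assume that $\tilde r(f'_v)<1$, where $\tilde r$ is Bonsall's spectral radius defined with respect to the norm $\|\cdot\|_E$. Then $$\limsup_{k\to\infty} d(f^k(x),v)^{1/k}\le \tilde r(f'_v)\qquad\text{for all }x\in G.$$ In particular, the fixed point of $f$ in $G$ is unique.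
   Context: Semidifferentiability: let $X,Y$ be normed spaces, $G\subset X$, and $v$ an interior point of $G$. A map $f:G\to Y$ is semidifferentiable at $v$ if there exists a continuous, positively homogeneous map $h:X\to Y$ (i.e. $h(tx)=th(x)$ for all $t>0$, $x\in X$) such that $f(v+x)=f(v)+h(x)+o(\|x\|)$ as $x\to0$. Such $h$ is unique; it is called the semidifferential of $f$ at $v$ and denoted $f'_v$. Bonsall's spectral radius: for a continuous positively homogeneous self-map $h$ of a normed space $(E,\|\cdot\|)$, put $\|h\|=\sup_{x\ne0}\|h(x)\|/\|x\|<\infty$ and $\tilde r(h)=\lim_{k\to\infty}\|h^k\|^{1/k}=\inf_{k\ge1}\|h^k\|^{1/k}$, where $h^k$ is the $k$-th iterate. Similarly $f^k$ is the $k$-th iterate of $f$. *)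

(* Defs.v *)
From HB Require Import structures.
From mathcomp Require Import all_boot all_order all_algebra.
From mathcomp Require Import all_classical all_reals all_analysis.
Import Order.TTheory GRing.Theory Num.Theory.
Import numFieldNormedType.Exports.

Set Implicit Arguments.
Unset Strict Implicit.
Unset Printing Implicit Defensive.

Local Open Scope classical_set_scope.
Local Open Scope ring_scope.

#[short(type="completeMetricType")]
HB.structure Definition CompleteMetric (R : numDomainType) :=
  {M of Metric R M & Complete M}.

Definition positively_homogeneous (R : realType) (X Y : normedModType R)
    (h : X -> Y) : Prop :=
  forall (t : R) (x : X), 0 < t -> h (t *: x) = t *: h x.

(* A map G -> Y is a total function X -> Y of which only the values on G
   matter: v being interior to G, the expansion at v ignores the others. *)
Definition is_semidifferential (R : realType) (X Y : normedModType R)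
    (G : set X) (f : X -> Y) (v : X) (h : X -> Y) : Prop :=
  [/\ G° v,
      continuous h,
      positively_homogeneous h &
      (fun x : X => f (v + x) - (f v + h x)) =o_ (0 : X) (id : X -> X)].

(* On X = {0} the supremum is over the empty set, and sup set0 = 0. *)
Definition homog_norm (R : realType) (X : normedModType R) (h : X -> X) : R :=
  sup [set `|h x| / `|x| | x in [set x : X | x != 0]].

Definition bonsall_radius (R : realType) (X : normedModType R)
    (h : X -> X) : R :=
  limn (fun k : nat => homog_norm (iter k h) `^ (k%:R^-1)).

(* Main.v *)
(** The metric [d] and the norm are asymptotically equal at [v], so the
    difference quotients of [f] at [v], hence also [f'v], are nonexpansive for
    the norm. This makes the chain rule available: [iter m f'v] is the
    semidifferential of [iter m f] at [v]. It also bounds the norms of the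
    iterates of [f'v], so that Fekete's lemma gives the existence of the limit
    [r] defining Bonsall's radius. For [r < mu < 1], some iterate [iter m f'v]
    has norm less than [mu ^+ m], hence [iter m f] contracts the distance to
    [v] by [mu ^+ m] near [v]; nonexpansiveness interpolates between multiples
    of [m]. Finally the set of points whose orbit comes close to [v] is open
    and relatively closed in [G], because [f] is nonexpansive, so it is [G]
    by connectedness. *)
Require Import Defs.
From mathcomp Require Import all_boot all_order all_algebra.
From mathcomp Require Import all_classical all_reals all_analysis.
From mathcomp Require Import ring lra.
Import Order.TTheory GRing.Theory Num.Theory.
Import numFieldNormedType.Exports.

Set Implicit Arguments.
Unset Strict Implicit.
Unset Printing Implicit Defensive.

Local Open Scope classical_set_scope.
Local Open Scope ring_scope.


(** * Growth rates of bounded real sequences *)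

Lemma geometric_decay (R : realType) (u : nat -> R) (K mu : R) (m k : nat) :
  (0 < m)%N -> 0 < mu -> (forall n, 0 <= u n <= K) ->
  (forall n, (k <= n)%N -> u (m + n)%N <= mu ^+ m * u n) ->
  exists C, forall n, u n <= C * mu ^+ n.
Proof.
(* The recursion only reaches indices from [m + k] on; the factor [1 + D] covers the earlier terms,
   [1] serving the case [1 <= mu] and [D] the case [mu < 1]. *)
move=> m0 mu0 uK umn; pose D := mu ^- (m + k); exists (K * (1 + D)) => n.
have D0 : 0 < D by rewrite invr_gt0 exprn_gt0.
have K0 : 0 <= K by have /andP[u0] := uK 0%N; apply: le_trans.
elim/ltn_ind: n => n IH; have [nmk|mkn] := ltnP n (m + k).
  have /andP[_ /le_trans] := uK n; apply; rewrite -mulrA ler_peMr//.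
  have [mu1|/ltW mu1] := leP 1 mu.
    by rewrite -[leLHS]mul1r ler_pM ?exprn_ege1// lerDl ltW.
  rewrite mulrDl mul1r (le_trans _ (_ : D * mu ^+ n <= _))//; last first.
    by rewrite lerDr exprn_ge0 ?(ltW mu0).
  rewrite mulrC ler_pdivlMr ?exprn_gt0// mul1r.
  by rewrite ler_wiXn2l ?(ltW mu0) ?(ltnW nmk).
have mn : (m <= n)%N by rewrite (leq_trans _ mkn)// leq_addr.
rewrite -(subnKC mn) (le_trans (umn _ _))//; first by rewrite leq_subRL.
rewrite exprD mulrCA ler_wpM2l ?exprn_ge0 ?(ltW mu0)//.
by apply: IH; rewrite ltn_subrL m0 (leq_trans m0 mn).
Qed.

(** The strict gap absorbs the constant: [C * (mu / nu) ^+ n] tends to 0, hence is eventually below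
    1. *)
Lemma root_le_of_geometric (R : realType) (u : nat -> R) (C mu nu : R) :
  0 < mu < nu -> (forall n, 0 <= u n <= C * mu ^+ n) ->
  \forall n \near \oo, u n `^ n%:R^-1 <= nu.
Proof.
move=> /andP[mu0 munu] uC; have nu0 := lt_trans mu0 munu.
have q1 : `|mu / nu| < 1.
  by rewrite ger0_norm ?divr_ge0 ?ltW// ltr_pdivrMr// mul1r.
have /cvgrPdist_lt/(_ 1 ltr01) := cvg_geometric C q1.
apply: filterS2 (nbhs_infty_gt 0) => n n0; rewrite sub0r normrN /= => Cn.
have /andP[un0 unC] := uC n.
have unn : u n <= nu ^+ n.
  apply: (le_trans unC); have := ltW (le_lt_trans (ler_norm _) Cn).
  by rewrite expr_div_n mulrA ler_pdivrMr ?exprn_gt0// mul1r.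
have ni0 : 0 <= n%:R^-1 :> R by rewrite invr_ge0.
rewrite (le_trans (ge0_ler_powR ni0 _ _ unn)) ?nnegrE ?exprn_ge0 ?(ltW nu0)//.
rewrite -(powR_mulrn n (ltW nu0)) -powRrM mulfV ?pnatr_eq0 -?lt0n//.
by rewrite powRr1 ?(ltW nu0).
Qed.

(** Fekete's argument: the limit is the infimum of the roots of positive index, and one near-optimal
    index [m] controls all large [n] by geometric decay. *)
Lemma cvg_root_of_submultiplicative (R : realType) (a : nat -> R) (K : R) :
  (forall n, 0 <= a n <= K) ->
  (forall m n, a (m + n)%N <= a m * a n) ->
  cvgn (fun n => a n `^ n%:R^-1).
Proof.
move=> aK asub; pose S := [set a n `^ n%:R^-1 | n in [set n | (0 < n)%N]].
have S_ge0 : lbound S 0 by move=> _ [n _ <-]; exact: powR_ge0.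
have S0 : has_inf S by split; [exists (a 1%N `^ 1^-1), 1%N|exists 0].
apply/cvg_ex; exists (inf S); apply/cvgrPdist_le => e e0.
have L0 : 0 <= inf S by apply: lb_le_inf => //; case: S0.
have e20 : 0 < e / 2 by rewrite divr_gt0.
have [_ [m m0 <-] sm] := inf_adherent e20 S0.
have am : a m <= (inf S + e / 2) ^+ m.
  have /andP[am0 _] := aK m.
  have := lerXn2r m (powR_ge0 _ _) _ (ltW sm).
  rewrite -(powR_mulrn _ (powR_ge0 _ _)) -powRrM mulVf ?pnatr_eq0 -?lt0n//.
  by rewrite powRr1// nnegrE; apply; rewrite addr_ge0 ?(ltW e20).
have [|n _|C aC] := @geometric_decay R a K (inf S + e / 2) m 0 m0 _ aK.
- by rewrite ltr_wpDl.
- by rewrite (le_trans (asub m n))// ler_wpM2r//; have /andP[] := aK n.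
have := @root_le_of_geometric R a C (inf S + e / 2) (inf S + e).
case=> [||N _ HN].
- by rewrite ltr_wpDl// ltrD2l ltr_pdivrMr// mulr_natr mulr2n ltrDl.
- by move=> n; rewrite aC; have /andP[->] := aK n.
(* Starting at [N.+1] forces [n] to be positive, as membership in [S] requires. *)
exists N.+1 => // n /= Nn; rewrite ler_distlC.
have n0 : (0 < n)%N by apply: leq_trans Nn.
rewrite (HN n (ltnW Nn)) andbT (le_trans (_ : _ <= inf S)) ?gerBl ?(ltW e0)//.
by apply: ge_inf; [case: S0|exists n].
Qed.

(** * Norms of iterates and Bonsall's radius *)

Section nonexpansive_norm.
Variables (R : realType) (E : normedModType R).
Implicit Types (g h : E -> E) (K : R).

Lemma homog_norm_ge0 g : 0 <= homog_norm g.
Proof.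
rewrite /homog_norm; set S := image _ _.
have [[[y Sy] Sb]|/sup_out ->//] := pselect (has_sup S).
apply: (@le_trans _ _ y); last exact: ub_le_sup.
by have [x _ <-] := Sy; rewrite divr_ge0.
Qed.

Lemma homog_norm_le g K : 0 <= K -> (forall x, `|g x| <= K * `|x|) ->
  homog_norm g <= K.
Proof.
move=> K0 gK; rewrite /homog_norm; set S := image _ _.
have SK : ubound S K.
  by move=> _ [x x0 <-]; rewrite ler_pdivrMr ?normr_gt0.
have [->|S0] := eqVneq S set0; first by rewrite sup0.
by apply: ge_sup => //; exact/set0P.
Qed.

(** The bound by [K] keeps the supremum from being the default value 0 of an unbounded set;
    [g 0 = 0] handles the point left out of it. *)
Lemma norm_le_homog_norm g K x : g 0 = 0 -> (forall x, `|g x| <= K * `|x|) ->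
  `|g x| <= homog_norm g * `|x|.
Proof.
move=> g0 gK; have [->|x0] := eqVneq x 0; first by rewrite g0 normr0 mulr0.
rewrite -ler_pdivrMr ?normr_gt0//; apply: ub_le_sup; last by exists x.
by exists K => _ [y y0 <-]; rewrite ler_pdivrMr ?normr_gt0.
Qed.

Lemma positively_homogeneous0 h : positively_homogeneous h -> h 0 = 0.
Proof.
move=> /(_ 2 0 (ltr0Sn R 1)); rewrite scaler0 scaler_nat mulr2n => /eqP.
by rewrite -subr_eq0 opprD addrA subrr sub0r oppr_eq0 => /eqP.
Qed.

Lemma iter_norm_le h k x : (forall x, `|h x| <= `|x|) -> `|iter k h x| <= `|x|.
Proof. by move=> h1; elim: k => //= k; apply: le_trans. Qed.

(** The norms of the iterates are at most 1 and submultiplicative, so Fekete's argument applies. *)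
Lemma cvg_bonsall_radius h : h 0 = 0 -> (forall x, `|h x| <= `|x|) ->
  cvgn (fun k => homog_norm (iter k h) `^ k%:R^-1).
Proof.
move=> h0 h1; have ih0 k : iter k h 0 = 0 by elim: k => //= k ->.
have ih1 k x : `|iter k h x| <= 1 * `|x| by rewrite mul1r iter_norm_le.
apply: (@cvg_root_of_submultiplicative _ _ 1) => [k|m n].
  by rewrite homog_norm_ge0 homog_norm_le.
apply: homog_norm_le; first by rewrite mulr_ge0 ?homog_norm_ge0.
move=> x; rewrite iterD (le_trans (norm_le_homog_norm _ (ih0 m) (ih1 m)))//.
by rewrite -mulrA ler_wpM2l ?homog_norm_ge0// (norm_le_homog_norm _ _ (ih1 n)).
Qed.

Lemma bonsall_radius_ge0 h : h 0 = 0 -> (forall x, `|h x| <= `|x|) ->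
  0 <= bonsall_radius h.
Proof.
move=> h0 h1; apply: limr_ge; first exact: cvg_bonsall_radius.
by near=> n; exact: powR_ge0.
Unshelve. all: by end_near. Qed.

Lemma bonsall_radius_lt h mu : h 0 = 0 -> (forall x, `|h x| <= `|x|) ->
  bonsall_radius h < mu ->
  exists2 m, (0 < m)%N & homog_norm (iter m h) < mu ^+ m.
Proof.
move=> h0 h1 rmu; have mu0 := le_lt_trans (bonsall_radius_ge0 h0 h1) rmu.
have := cvgr_lt _ (cvg_bonsall_radius h0 h1) _ rmu.
move=> [N _ /(_ N.+1 (leqnSn N))/= sN]; exists N.+1 => //.
have := ltrXn2r N.+1 (powR_ge0 _ _) sN.
rewrite /= -(powR_mulrn N.+1 (powR_ge0 _ _)) -powRrM mulVf ?pnatr_eq0//.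
by rewrite powRr1// homog_norm_ge0.
Qed.

End nonexpansive_norm.

(** * Orbits of a nonexpansive map around a fixed point *)

Section metric_basin.
Variables (R : realType) (V : metricType R) (G : set V) (f : V -> V) (v : V).
Hypotheses (f_G : set_fun G G f) (G_v : G v) (f_v : f v = v).
Hypothesis f_nonexpansive : forall x y, G x -> G y ->
  mdist (f x) (f y) <= mdist x y.

Lemma nbhs_mdistP (x : V) (P : set V) :
  nbhs x P <-> exists2 e : R, 0 < e & forall y, mdist x y < e -> P y.
Proof.
rewrite -nbhs_ballE; split=> -[e /= e0 xe]; exists e => // y.
  by move=> xy; apply: xe; rewrite ballEmdist.
by rewrite ballEmdist; exact: xe.
Qed.

Lemma iter_stable k x : G x -> G (iter k f x).
Proof. by move=> Gx; elim: k => //= k; exact: f_G. Qed.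

Lemma iter_nonexpansive k x y : G x -> G y ->
  mdist (iter k f x) (iter k f y) <= mdist x y.
Proof.
move=> Gx Gy; elim: k => //= k; apply: le_trans.
by apply: f_nonexpansive; exact: iter_stable.
Qed.

Lemma iter_fixed k : iter k f v = v.
Proof. by elim: k => //= k ->. Qed.

Lemma iter_mdist_le k x : G x -> mdist (iter k f x) v <= mdist x v.
Proof.
by move=> Gx; rewrite -[in leLHS](iter_fixed k); exact: iter_nonexpansive.
Qed.

Lemma geometric_convergence (m : nat) (mu : R) : open G -> connected G ->
  (0 < m)%N -> 0 < mu < 1 ->
  (\forall x \near v, mdist (iter m f x) v <= mu ^+ m * mdist x v) ->
  forall x, G x -> exists C, forall n, mdist (iter n f x) v <= C * mu ^+ n.
Proof.
move=> oG cG m0 /andP[mu0 mu1] /nbhs_mdistP[d d0 fm].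
(* Distances to [v] never increase along an orbit, so an orbit that comes within [d] of [v] stays
   where [iter m f] contracts. *)
have capture k x : G x -> mdist (iter k f x) v < d ->
    exists C, forall n, mdist (iter n f x) v <= C * mu ^+ n.
  move=> Gx kx; apply: (@geometric_decay _ _ (mdist x v) mu m k) => // [n|n kn].
    by rewrite mdist_ge0 iter_mdist_le.
  rewrite iterD; apply: fm; rewrite metric_sym (le_lt_trans _ kx)//.
  by rewrite -(subnK kn) iterD iter_mdist_le//; exact: iter_stable.
pose A := [set x | G x /\ exists k, mdist (iter k f x) v < d].
suff AG : A = G by move=> x; rewrite -AG => -[Gx [k]]; exact: capture.
apply: cG.
- by exists v; split => //; exists 0%N; rewrite mdistxx.
(* A perturbation smaller than the slack [d - mdist (iter k f x) v] keeps the [k]-th iterate within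
   [d] of [v]. *)
- exists A; last by apply/seteqP; split => x [] // Gx ?; split.
  rewrite openE => x [Gx [k kx]]; rewrite /interior.
  have : nbhs x G by exact: open_nbhs_nbhs.
  apply: filterS2 (_ : nbhs x [set y | mdist x y < d - mdist (iter k f x) v]).
    move=> y xy Gy; split => //; exists k.
    rewrite (le_lt_trans (metric_triangle _ (iter k f x) _))//.
    by rewrite -ltrBrDr metric_sym (le_lt_trans (iter_nonexpansive _ _ _)).
  by apply/nbhs_mdistP; exists (d - mdist (iter k f x) v); rewrite ?subr_gt0.
exists (closure A); first exact: closed_closure.
apply/seteqP; split => y.
  by move=> Ay; split; [case: Ay|exact: subset_closure].
(* A limit point [y] is within [d / 2] of some [x] in [A], whose orbit comes within [d / 2] of [v]
   by geometric decay; nonexpansiveness lets the two bounds add up. *)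
have d20 : 0 < d / 2 by rewrite divr_gt0.
move=> [Gy /(_ [set x | mdist y x < d / 2])[]].
  by apply/nbhs_mdistP; exists (d / 2).
move=> x [[Gx [k kx]] yx]; split => //.
have [C fC] := capture _ _ Gx kx.
have /cvgr0_norm_lt/(_ _ d20)[N _ /(_ N (leqnn N)) CN] :
    C * mu ^+ n @[n --> \oo] --> 0.
  by apply: cvg_geometric; rewrite ger0_norm ?ltW.
exists N; rewrite (le_lt_trans (metric_triangle _ (iter N f x) _))//.
rewrite [ltRHS]splitr ltr_leD//.
  by rewrite (le_lt_trans (iter_nonexpansive _ _ _)).
by rewrite (le_trans (fC N))// (le_trans (ler_norm _))// ltW.
Qed.

End metric_basin.

(** * Semidifferentials of nonexpansive maps and of their iterates *)

Section semidifferential_nonexpansive.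
Variables (R : realType) (V : metricType R) (G : set V) (f : V -> V) (v : V).
Hypotheses (G_open : open G) (f_G : set_fun G G f) (G_v : G v) (f_v : f v = v).
Hypothesis f_nonexpansive : forall x y, G x -> G y ->
  mdist (f x) (f y) <= mdist x y.
Variables (E : normedModType R) (iota : V -> E).
Hypothesis iota_open : open (range iota).
Hypothesis same_topology : forall U : set V, open U <-> open (iota @` U).
Hypothesis dist_norm : forall lambda : R, 1 < lambda ->
  exists2 U : set V, nbhs v U &
    forall x y : V, U x -> U y ->
      lambda^-1 * `|iota x - iota y| <= mdist x y
      /\ mdist x y <= lambda * `|iota x - iota y|.
Variables (fE h : E -> E).
Hypothesis fE_f : forall x, G x -> fE (iota x) = iota (f x).
Hypothesis f_semidiff : is_semidifferential (iota @` G) fE (iota v) h.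

Lemma nbhs_image (U : set V) : nbhs v U -> nbhs (iota v) (iota @` U).
Proof.
rewrite nbhsE => -[B [oB Bv] BU]; rewrite nbhsE; exists (iota @` B).
  by split; [exact/same_topology|exists v].
exact: image_subset.
Qed.

(** The image of the preimage of an open set is its trace on the range, which is open because the
    range is. *)
Lemma embedding_continuous : continuous iota.
Proof.
apply/continuousP => A oA; apply/same_topology.
rewrite (_ : _ @` _ = A `&` range iota); first exact: openI.
apply/seteqP; split => [_ [x Ax <-]|z [Az [x _ xz]]].
  by split => //; exists x.
by exists x; rewrite /preimage /= ?xz.
Qed.

Lemma semidiff_remainder (e : R) : 0 < e ->
  \forall x \near (0 : E),
    `|fE (iota v + x) - iota v - h x| <= e * `|x|.
Proof.
case: f_semidiff => _ _ _ /eqoP fo e0.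
by apply: filterS (fo e e0) => x; rewrite fE_f// f_v opprD addrA.
Qed.

(* [f] is [lambda ^+ 2]-Lipschitz for the norm near [v], for every
   [lambda > 1]; the difference quotients inherit this. *)
Lemma semidifferential_nonexpansive (x y : E) : `|h x - h y| <= `|x - y|.
Proof.
have [_ _ hom _] := f_semidiff.
have key (lambda e : R) : 1 < lambda -> 0 < e ->
    `|h x - h y| <= lambda ^+ 2 * `|x - y| + e * (`|x| + `|y|).
  move=> l1 e0; have l0 : 0 < lambda := lt_trans ltr01 l1.
  have [U /nbhs_mdistP[d d0 dU] Ul] := dist_norm l1.
  pose B := [set z | G z /\ mdist v z < d].
  have vB : nbhs v B.
    apply: filterI; first exact: open_nbhs_nbhs.
    by apply/nbhs_mdistP; exists d.
  have iB := nbhs_image vB.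
  have cvg0 (z : E) : t *: z @[t --> 0^'+] --> (0 : E).
    rewrite -[X in _ --> X](scale0r z); apply: cvgZr_tmp.
    exact: cvg_at_right_filter.
  have cvgv (z : E) : iota v + t *: z @[t --> 0^'+] --> iota v.
    by rewrite -[X in _ --> X]addr0; apply: cvgD; [exact: cvg_cst|exact: cvg0].
  near (0 : R)^'+ => t.
  have t0 : 0 < t by [].
  have rem (z : E) :
      `|fE (iota v + t *: z) - iota v - h (t *: z)| <= e * `|t *: z| ->
      `|fE (iota v + t *: z) - iota v - t *: h z| <= e * t * `|z|.
    by rewrite hom// normrZ gtr0_norm// mulrA.
  have /rem xr : `|fE (iota v + t *: x) - iota v - h (t *: x)| <= e * `|t *: x|.
    by near: t; exact: (cvg0 _ _ (semidiff_remainder e0)).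
  have /rem yr : `|fE (iota v + t *: y) - iota v - h (t *: y)| <= e * `|t *: y|.
    by near: t; exact: (cvg0 _ _ (semidiff_remainder e0)).
  have [a [Ga va] ax] : (iota @` B) (iota v + t *: x).
    by near: t; exact: (cvgv _ _ iB).
  have [b [Gb vb] bx] : (iota @` B) (iota v + t *: y).
    by near: t; exact: (cvgv _ _ iB).
  (* Since [v] is fixed, [f] keeps the points of [B] in [U], so metric and norm can be compared both
     before and after applying [f]. *)
  have fB z : G z -> mdist v z < d -> U (f z).
    move=> Gz vz; apply: dU; rewrite -[X in mdist X _]f_v.
    exact: le_lt_trans (f_nonexpansive G_v Gz) vz.
  have fab : `|iota (f a) - iota (f b)| <= lambda ^+ 2 * (t * `|x - y|).
    have [+ _] := Ul _ _ (fB _ Ga va) (fB _ Gb vb).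
    rewrite mulrC ler_pdivrMr// => /le_trans; apply.
    rewrite mulrC expr2 -mulrA ler_wpM2l ?(ltW l0)//.
    rewrite (le_trans (f_nonexpansive Ga Gb))//.
    have [_] := Ul _ _ (dU _ va) (dU _ vb).
    by rewrite ax bx opprD addrACA subrr add0r -scalerBr normrZ gtr0_norm.
  rewrite -ax fE_f// in xr; rewrite -bx fE_f// in yr.
  rewrite -(ler_pM2l t0) -[X in X * `|_|](gtr0_norm t0) -normrZ scalerBr.
  set p := iota (f a) in xr fab; set q := iota (f b) in yr fab.
  have -> : t *: h x - t *: h y =
      (p - q) - (p - iota v - t *: h x) + (q - iota v - t *: h y).
    rewrite (_ : p - q = (p - iota v) - (q - iota v)); last first.
      by rewrite opprB addrA subrK.
    move: (p - iota v) (q - iota v) => P Q.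
    by rewrite opprB [X in _ = X + _]addrC !addrA !subrK.
  rewrite (le_trans (ler_normD _ _))//.
  rewrite (le_trans (lerD (ler_normB _ _) (lexx _)))//.
  rewrite (le_trans (lerD (lerD fab xr) yr))//.
  by rewrite le_eqVlt; apply/orP; left; apply/eqP; ring.
apply/ler_addgt0Pr => e e0.
(* As [s <= 1], [(1 + s) ^+ 2 <= 1 + 3 * s], so [key] at [1 + s] and [s] has error at most [s * S];
   the final [+ 1] keeps [S] positive. *)
pose S := 3 * `|x - y| + (`|x| + `|y|) + 1.
have S0 : 0 < S by rewrite ltr_wpDl// !addr_ge0// mulr_ge0.
pose s := Num.min 1 (e / S).
have s0 : 0 < s by rewrite lt_min ltr01 divr_gt0.
have s1 : s <= 1 by rewrite ge_min lexx.
have sS : s * S <= e by rewrite -ler_pdivlMr// ge_min lexx orbT.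
have := key (1 + s) s; rewrite ltrDl s0 => /(_ isT isT) /le_trans; apply.
have xy0 := normr_ge0 (x - y).
rewrite /S in sS; move: (normr_ge0 x) (normr_ge0 y) => x0 y0.
have : s * s * `|x - y| <= s * `|x - y|.
  by rewrite -mulrA ler_piMl// mulr_ge0// ltW.
by move: sS; nra.
Unshelve. all: by end_near. Qed.

Lemma near_iter (k : nat) (P : set V) :
  nbhs v P -> \forall x \near v, P (iter k f x).
Proof.
move=> /nbhs_mdistP[d d0 dP].
have vG : nbhs v G by exact: open_nbhs_nbhs.
apply: filterS2 vG (_ : nbhs v [set x | mdist v x < d]) => [x Gx vx|].
  apply: dP; rewrite metric_sym; apply: le_lt_trans vx.
  rewrite [leRHS]metric_sym.
  exact: (iter_mdist_le f_G G_v f_v f_nonexpansive).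
by apply/nbhs_mdistP; exists d.
Qed.

Lemma semidifferential_expansion (e : R) : 0 < e ->
  \forall x \near v,
    `|iota (f x) - iota v - h (iota x - iota v)| <= e * `|iota x - iota v|.
Proof.
move=> e0; have vG : nbhs v G by exact: open_nbhs_nbhs.
have cv : iota x - iota v @[x --> v] --> (0 : E).
  rewrite -(subrr (iota v)); apply: cvgB; last exact: cvg_cst.
  exact: embedding_continuous.
apply: filterS2 vG (cv _ (semidiff_remainder e0)) => x Gx /=.
by rewrite subrKC fE_f.
Qed.

(** Chain rule by induction: nonexpansiveness of [h] carries the remainder of [iter k f] through [h]
    without loss. *)
Lemma iterate_semidifferential (k : nat) (e : R) : 0 < e ->
  \forall x \near v,
    `|iota (iter k f x) - iota v - iter k h (iota x - iota v)|
      <= e * `|iota x - iota v|.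
Proof.
have l2 : (1 : R) < 2 by rewrite ltr1n.
have [U vU Ul] := dist_norm l2.
have Uv : U v by exact: nbhs_singleton.
elim: k e => [|k IH] e e0 /=.
  by apply: nearW => x; rewrite subrr normr0 mulr_ge0// ltW.
(* Two comparisons with constant 2 bound the displacement of [iter k f x] by 4 times that of [x], so
   [e / 8] contributes [e / 2]. *)
have e80 : 0 < e / 8 by rewrite divr_gt0.
have e20 : 0 < e / 2 by rewrite divr_gt0.
near=> x.
set y := iter k f x.
have fy : `|iota (f y) - iota v - h (iota y - iota v)|
    <= e / 8 * `|iota y - iota v|.
  by rewrite /y; near: x; exact: (near_iter _ (semidifferential_expansion e80)).
have hy : `|iota y - iota v - iter k h (iota x - iota v)|
    <= e / 2 * `|iota x - iota v|.
  by rewrite /y; near: x; exact: IH.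
have Uy : U y by rewrite /y; near: x; exact: near_iter.
have Ux : U x by near: x.
have Gx : G x by near: x; exact: open_nbhs_nbhs.
have yx : `|iota y - iota v| <= 4 * `|iota x - iota v|.
  have [+ _] := Ul _ _ Uy Uv; rewrite mulrC ler_pdivrMr// => /le_trans; apply.
  have [_ xv] := Ul _ _ Ux Uv.
  have := iter_mdist_le f_G G_v f_v f_nonexpansive k Gx.
  by rewrite -/y; lra.
rewrite -(subrK (h (iota y - iota v)) (iota (f y) - iota v)) -addrA.
rewrite (le_trans (ler_normD _ _))//.
rewrite (le_trans (lerD fy (semidifferential_nonexpansive _ _)))//.
have : e / 8 * `|iota y - iota v| <= e / 8 * (4 * `|iota x - iota v|).
  by rewrite ler_pM2l.
by move: hy; lra.
Unshelve. all: by end_near. Qed.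

Lemma iterate_contraction (m : nat) (q c : R) : 0 <= q < c ->
  (forall x, `|iter m h x| <= q * `|x|) ->
  \forall x \near v, mdist (iter m f x) v <= c * mdist x v.
Proof.
move=> /andP[q0 qc] hq; pose e := (c - q) / 2.
have e0 : 0 < e by rewrite divr_gt0// subr_gt0.
have qe0 : 0 < q + e by rewrite ltr_wpDl.
have rho1 : 1 < c / (q + e) by rewrite ltr_pdivlMr// mul1r /e; lra.
(* Passing from the metric to the norm and back costs [lambda] twice; this choice makes the total
   constant exactly [c]. *)
pose lambda := Num.sqrt (c / (q + e)).
have l1 : 1 < lambda by rewrite -[ltLHS]sqrtr1 ltr_sqrt// (lt_trans ltr01).
have l0 : 0 < lambda := lt_trans ltr01 l1.
have lc : lambda * (q + e) * lambda = c.
  by rewrite mulrAC -expr2 sqr_sqrtr ?(ltW (lt_trans ltr01 _))// divfK ?gt_eqF.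
have [U vU Ul] := dist_norm l1.
have Uv : U v by exact: nbhs_singleton.
near=> x.
have Ux : U x by near: x.
have Uy : U (iter m f x) by near: x; exact: near_iter.
have [_ /le_trans] := Ul _ _ Uy Uv; apply.
rewrite -lc -!mulrA ler_pM2l//.
have xm : `|iota (iter m f x) - iota v - iter m h (iota x - iota v)|
    <= e * `|iota x - iota v|.
  by near: x; exact: iterate_semidifferential.
rewrite -(subrK (iter m h (iota x - iota v)) (iota (iter m f x) - iota v)).
rewrite (le_trans (ler_normD _ _))// (le_trans (lerD xm (hq _)))//.
rewrite -mulrDl [e + q]addrC ler_pM2l// -ler_pdivrMl//.
by have [] := Ul _ _ Ux Uv.
Unshelve. all: by end_near. Qed.

End semidifferential_nonexpansive.

(** * From geometric bounds to the upper limit and uniqueness *)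

Lemma limn_esup_root_le (R : realType) (u : nat -> R) (C mu nu : R) :
  0 < mu < nu -> (forall n, 0 <= u n <= C * mu ^+ n) ->
  (limn_esup (fun n => (u n `^ n%:R^-1)%:E) <= nu%:E)%E.
Proof.
move=> munu uC; pose S := [set n | u n `^ n%:R^-1 <= nu].
(* The upper limit is an infimum of suprema over the sets of the filter, and [S] is one of these
   sets. *)
apply: ge_ereal_inf; exists (ereal_sup ((fun n => (u n `^ n%:R^-1)%:E) @` S)).
  by exists S => //; exact: root_le_of_geometric munu uC.
by apply: ge_ereal_sup => _ [n /= un <-]; rewrite lee_fin.
Qed.

Theorem theorem6p8 (R : realType)
  (V : completeMetricType R)
  (G : set V) (G_open : open G) (G_connected : connected G)
  (f : V -> V) (f_G : set_fun G G f)
  (f_nonexpansive : forall x y : V, G x -> G y ->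
     mdist (f x) (f y) <= mdist x y)
  (v : V) (G_v : G v) (f_v : f v = v)
  (* V is an open subset of E through the inclusion iota *)
  (E : completeNormedModType R)
  (iota : V -> E) (iota_inj : injective iota)
  (iota_open : open (range iota))
  (same_topology : forall U : set V, open U <-> open (iota @` U))
  (dist_norm : forall lambda : R, 1 < lambda ->
     exists2 U : set V, nbhs v U &
       forall x y : V, U x -> U y ->
         lambda^-1 * `|iota x - iota y| <= mdist x y
         /\ mdist x y <= lambda * `|iota x - iota y|)
  (* fE is f seen as a map from G, included in E, to E *)
  (fE : E -> E) (fE_f : forall x : V, G x -> fE (iota x) = iota (f x))
  (f'v : E -> E)
  (f_semidiff : is_semidifferential (iota @` G) fE (iota v) f'v)
  (radius_lt1 : bonsall_radius f'v < 1) :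
  (forall x : V, G x ->
     (limn_esup (fun k : nat => (mdist (iter k f x) v `^ (k%:R^-1))%:E)
        <= (bonsall_radius f'v)%:E)%E)
  /\ (forall w : V, G w -> f w = w -> w = v).
Proof.
have [_ _ hom _] := f_semidiff.
have h0 := positively_homogeneous0 hom.
have h1 x : `|f'v x| <= `|x|.
  by have := semidifferential_nonexpansive G_open G_v f_v f_nonexpansive
    same_topology dist_norm fE_f f_semidiff x 0; rewrite h0 !subr0.
set r := bonsall_radius f'v in radius_lt1 *.
have r0 : 0 <= r by exact: bonsall_radius_ge0.
have geometric_bound mu : r < mu < 1 -> forall x, G x ->
    exists C, forall n, mdist (iter n f x) v <= C * mu ^+ n.
  move=> /andP[rmu mu1]; have mu0 := le_lt_trans r0 rmu.
  have [m m0 hm] := bonsall_radius_lt h0 h1 rmu.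
  apply: (geometric_convergence f_G G_v f_v f_nonexpansive (m := m)) => //.
    by rewrite mu0.
  apply: (iterate_contraction G_open f_G G_v f_v f_nonexpansive iota_open
    same_topology dist_norm fE_f f_semidiff
    (q := homog_norm (iter m f'v))).
  - by rewrite homog_norm_ge0 hm.
  - move=> x; apply: (@norm_le_homog_norm _ _ _ 1) => [|y].
      by elim: (m) => //= j ->.
    by rewrite mul1r iter_norm_le.
split=> [x Gx|w Gw fw].
  apply/lee_addgt0Pr => e e0.
  (* The rate [r + t] must stay below 1 for the contraction and strictly below [r + e] for the
     comparison of roots. *)
  pose t := Num.min ((1 - r) / 2) (e / 2).
  have t0 : 0 < t by rewrite lt_min !divr_gt0// subr_gt0.
  have t1 : t <= (1 - r) / 2 by rewrite ge_min lexx.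
  have te : t <= e / 2 by rewrite ge_min lexx orbT.
  have rt : r < r + t < 1 by apply/andP; split; lra.
  have [C fC] := geometric_bound _ rt _ Gx.
  apply: (@limn_esup_root_le _ _ C (r + t)) => [|n].
    by apply/andP; split; lra.
  by rewrite mdist_ge0 fC.
(* The orbit of [w] is constant, yet its distance to [v] is bounded by a vanishing geometric
   sequence; the midpoint serves as a rate between [r] and 1. *)
have r1 : r < (r + 1) / 2 < 1 by apply/andP; split; lra.
have [C fC] := geometric_bound _ r1 _ Gw.
apply: mdist_positivity; apply/eqP; rewrite eq_le mdist_ge0 andbT.
apply: (cvgr_to_ge (cvg_geometric C (_ : `|(r + 1) / 2| < 1))).
  by rewrite ltr_norml; apply/andP; split; lra.
by apply: nearW => n; rewrite -{1}(iter_fixed fw n) fC.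
Qed.
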